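(* (1) There exist finitely generated groups $G$ and $H$ that are quasi-isometric, such that $G$ is solvable but $H$ is not virtually solvable. (2) There exist finitely generated groups $G$ and $H$ that are quasi-isometric, such that $G$ has no torsion (i.e. no non-identity element of finite order), but no subgroup of finite index in $H$ is torsion-free.
   Context: All groups are finitely generated. For a finitely generated group $A$ with a finite symmetric generating system, $l_A(x)$ denotes the word length of $x\in A$ and $d_A(x,y)=l_A(xy^{-1})$ is the corresponding right-invariant word metric. Two finitely generated groups are quasi-isometric if they are quasi-isometric as metric spaces with respect to word metrics (this does not depend on the choice of finite generating systems). A group is virtually solvable if it has a solvable subgroup of finite index. *)

(* Defs.v *)
From mathcomp Require Import all_boot all_algebra.
From mathcomp Require Import boolp classical_sets cardinality reals.

Set Implicit Arguments.
Unset Strict Implicit.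
Unset Printing Implicit Defensive.

Local Open Scope classical_set_scope.
Local Open Scope group_scope.

Section Subgroups.
Variable G : groupType.
Implicit Types (A K : set G) (x y : G).

Definition is_subgroup K : Prop :=
  [/\ K 1, (forall x y, K x -> K y -> K (x * y)) & forall x, K x -> K x^-1].

Definition generated A : set G := smallest is_subgroup A.

Definition finite_index K : Prop :=
  finite_set [set [set k * x | k in K] | x in [set: G]].

Definition derived K : set G :=
  generated [set z | exists x y, [/\ K x, K y & z = [~ x, y]]].

Definition solvable_subgroup K : Prop := exists n, iter n derived K = [set 1].

Definition finite_order x : Prop := exists2 n, (0 < n)%N & x ^+ n = 1.

Definition torsion_free_subgroup K : Prop :=
  forall x, K x -> finite_order x -> x = 1.

End Subgroups.

Section Groups.
Variable G : groupType.

Definition finitely_generated : Prop :=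
  exists A : set G, finite_set A /\ generated A = [set: G].

Definition solvable_group : Prop := solvable_subgroup [set: G].

Definition virtually_solvable : Prop :=
  exists K : set G, [/\ is_subgroup K, finite_index K & solvable_subgroup K].

Definition torsion_free : Prop := torsion_free_subgroup [set: G].

End Groups.

Section WordMetric.
Variable G : groupType.
Implicit Types (A : set G) (x y : G).

Definition symmetric_generating_system A : Prop :=
  [/\ finite_set A, (forall x, A x -> A x^-1) & generated A = [set: G]].

Definition word_of A (n : nat) x : Prop :=
  exists w : seq G,
    [/\ size w = n, (forall a, a \in w -> A a) & \prod_(a <- w) a = x].

(* The least [n] with [word_of A n x]; the junk value 0, taken when [x] is not
   a product of elements of [A], never occurs for a symmetric generating
   system. *)
Definition word_length A x : nat :=
  xget 0%N [set n | word_of A n x /\ forall m, word_of A m x -> (n <= m)%N].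

Definition word_metric (R : realType) A x y : R :=
  ((word_length A (x / y))%:R)%R.

End WordMetric.

Section QuasiIsometry.
Variable R : realType.
Local Open Scope ring_scope.

Definition quasi_isometry (X Y : Type) (dX : X -> X -> R) (dY : Y -> Y -> R)
    (f : X -> Y) : Prop :=
  exists L C : R,
    [/\ 1 <= L, 0 <= C,
        (forall x y,
           L^-1 * dX x y - C <= dY (f x) (f y) <= L * dX x y + C)
      & forall y, exists x, dY (f x) y <= C].

(* Since the word metrics of a group for different finite generating systems
   are bi-Lipschitz equivalent, the choice of [A] and [B] is immaterial. *)
Definition quasi_isometric (G H : groupType) : Prop :=
  exists (A : set G) (B : set H),
    [/\ symmetric_generating_system A, symmetric_generating_system B
      & exists f : G -> H,
          quasi_isometry (word_metric R A) (word_metric R B) f].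

End QuasiIsometry.

(* Main.v *)
From HB Require Import structures.
From mathcomp Require Import all_boot all_algebra.
From mathcomp Require Import fingroup perm commutator finmap zify.
From mathcomp Require nilpotent alt.
From mathcomp Require Import boolp classical_sets cardinality reals.
Require Import Defs.
Import GRing.Theory Num.Theory.

(** Both pairs of groups are restricted wreath products over the integers,
    and the point is that the quasi-isometry class of [A wr B] depends on [A]
    only through its word metric.  Right-invariance of the metric makes edges
    left multiplications by generators.  With the law
      [(f, b) (g, c) = (x |-> f x * g (x b), b c)],
    a generator of [A] changes the single lamp [f 1], by a left
    multiplication, and a generator of [B] translates [f].  Hence, for a
    bilipschitz bijection [phi : A1 -> A2] with [phi 1 = 1], applying [phi] to
    every lamp commutes with the translations and distorts the other edges no
    more than [phi] does: it is a bilipschitz bijection from [A1 wr B] to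
    [A2 wr B] ([wreath_map_lipschitz], [wreath_quasi_isometric]).

    On the other side, a subgroup [K] of finite index of [A wr B], with [B]
    infinite, cannot tell all positions apart: by the pigeonhole principle
    there are two positions [x <> y] such that, for all [a] in a given finite
    part of [A], [K] contains the configuration with [a] at [x] and [a^-1] at
    [y] ([finite_index_twin]).

    (1) Take for [A1] a cyclic group of order 120 and for [A2] the symmetric
    group on five letters.  Any bijection of finite groups is bilipschitz.
    [A1 wr Z] is metabelian, whereas every [K] as above takes all values in
    [A2] at the position [x] on configurations with trivial cursor, so that no
    term of its derived series can be smaller than the corresponding term for
    the group [A2], which is not solvable.

    (2) Take [A1 = Z] and [A2 = Z/2 x Z], with the bilipschitz bijection that
    sends [n] to its parity and its half.  [Z wr Z] is torsion-free, whereas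
    every [K] as above contains the element of order two whose lamps are the
    involution of [A2] at two positions. *)

Set Implicit Arguments.
Unset Strict Implicit.
Unset Printing Implicit Defensive.

Local Open Scope classical_set_scope.
Local Open Scope group_scope.

(** * Generated subgroups and word lengths *)

Section Generated.
Variable G : groupType.
Implicit Types (A K : set G) (x y : G).

Lemma generated_subgroup A : is_subgroup (generated A).
Proof.
split=> [K [[]]|x y Ax Ay K KA|x Ax K KA] //; have [[_ KM KV] _] := KA.
- by apply: KM; [apply: (Ax K) | apply: (Ay K)].
- by apply: KV; apply: (Ax K).
Qed.

Lemma sub_generated A : A `<=` generated A.
Proof. exact: sub_gen_smallest. Qed.

Lemma generated_sub A K : is_subgroup K -> A `<=` K -> generated A `<=` K.
Proof. exact: smallest_sub. Qed.

Lemma is_subgroup1 : is_subgroup [set (1 : G)].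
Proof. by split=> [|x y /= -> ->|x /= ->]; rewrite ?mulg1 ?invg1. Qed.

Lemma derived_subgroup K : is_subgroup (derived K).
Proof. exact: generated_subgroup. Qed.

Lemma commutator_derived K x y : K x -> K y -> derived K [~ x, y].
Proof. by move=> Kx Ky; apply: sub_generated; exists x, y. Qed.

Lemma derived_sub K N : is_subgroup N ->
  (forall x y, K x -> K y -> N [~ x, y]) -> derived K `<=` N.
Proof.
by move=> sN KN; apply: generated_sub => // _ [x] [y] [Kx Ky ->]; apply: KN.
Qed.

Lemma finitely_generated_sgs A :
  symmetric_generating_system A -> finitely_generated G.
Proof. by case=> finA _ genA; exists A. Qed.

Lemma sgs_setT : finite_set [set: G] ->
  symmetric_generating_system [set: G].
Proof.
by move=> finG; split=> //; apply/seteqP; split=> // x _; apply: sub_generated.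
Qed.

End Generated.

Lemma generated_morph (G H : groupType) (h : UMagmaMorphism.type G H)
    (A : set G) (K : set H) :
  is_subgroup K -> (forall a, A a -> K (h a)) -> forall x, generated A x -> K (h x).
Proof.
move=> [K1 KM KV] AK x; apply: (@generated_sub _ _ (h @^-1` K)) => //=.
split=> [|y z Ky Kz|y Ky] /=.
- by rewrite gmulf1.
- by rewrite gmulfM; apply: KM.
- by rewrite gmulfV; apply: KV.
Qed.

Section WordLength.
Variables (G : groupType) (A : set G).
Hypothesis sgsA : symmetric_generating_system A.
Implicit Types x y : G.

Lemma word_ofM m n x y : word_of A m x -> word_of A n y -> word_of A (m + n) (x * y).
Proof.
move=> [w [<- Aw <-]] [v [<- Av <-]]; exists (w ++ v).
split; rewrite ?size_cat ?big_cat // => a.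
by rewrite mem_cat => /orP[/Aw|/Av].
Qed.

Lemma word_of1 : word_of A 0 1.
Proof. by exists [::]; rewrite big_nil. Qed.

Lemma word_of_gen a : A a -> word_of A 1 a.
Proof. by move=> Aa; exists [:: a]; rewrite big_seq1; split=> // b /[!inE] /eqP->. Qed.

Lemma word_ofV n x : word_of A n x -> word_of A n x^-1.
Proof.
have [_ AV _] := sgsA.
move=> [w [<- Aw <-]]; exists (rev [seq a^-1 | a <- w]).
split; rewrite ?size_rev ?size_map //.
  by move=> a; rewrite mem_rev => /mapP[b wb ->]; apply/AV/Aw.
elim: w {Aw} => [|a w IHw]; first by rewrite !big_nil invg1.
by rewrite /= rev_cons -cats1 big_cat /= big_seq1 IHw big_cons invgM.
Qed.

Lemma word_of_ex x : exists n, word_of A n x.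
Proof.
have [_ _ genA] := sgsA.
have: generated A x by rewrite genA.
apply: (@generated_sub _ _ [set y | exists n, word_of A n y]) => [|a Aa].
  split=> [|y z [m wy] [n wz]|y [n wy]].
  - by exists 0%N; apply: word_of1.
  - by exists (m + n)%N; apply: word_ofM.
  - by exists n; apply: word_ofV.
by exists 1%N; apply: word_of_gen.
Qed.

Lemma word_lengthP x :
  word_of A (word_length A x) x /\
  forall m, word_of A m x -> (word_length A x <= m)%N.
Proof.
apply: (@xgetPex _ 0%N
  [set n | word_of A n x /\ forall m, word_of A m x -> (n <= m)%N]).
have exw : exists n, `[< word_of A n x >].
  by have [n xn] := word_of_ex x; exists n; apply/asboolP.
exists (ex_minn exw); case: ex_minnP => n /asboolP xn minn; split=> // m xm.
by apply: minn; apply/asboolP.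
Qed.

Lemma word_length_le n x : word_of A n x -> (word_length A x <= n)%N.
Proof. exact: (word_lengthP x).2. Qed.

Lemma word_length1 : word_length A 1 = 0%N.
Proof. by apply/eqP; rewrite -leqn0; apply/word_length_le/word_of1. Qed.

Lemma word_length_gen a : A a -> (word_length A a <= 1)%N.
Proof. by move=> Aa; apply/word_length_le/word_of_gen. Qed.

Lemma word_lengthM x y :
  (word_length A (x * y) <= word_length A x + word_length A y)%N.
Proof.
apply: word_length_le; apply: word_ofM.
  by case: (word_lengthP x).
by case: (word_lengthP y).
Qed.

Lemma word_length_mul_gens a b : A a -> A b -> (word_length A (a * b) <= 2)%N.
Proof.
move=> Aa Ab; apply: leq_trans (word_lengthM a b) _.
by rewrite -[2%N]/(1 + 1)%N leq_add ?word_length_gen.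
Qed.

End WordLength.

(** * Lipschitz maps between groups *)

Definition lipschitz (G H : groupType) (A : set G) (B : set H) (c : nat)
    (f : G -> H) : Prop :=
  forall x y, (word_length B (f x / f y) <= c * word_length A (x / y))%N.

(** The metric is right-invariant, so [x] and [a * x] are adjacent for every
    generator [a]; concatenating edges along a geodesic from [y] to [x], it is
    enough to control the displacement of [f] across each edge. *)
Lemma lipschitz_edges (G H : groupType) (A : set G) (B : set H) c (f : G -> H) :
    symmetric_generating_system A -> symmetric_generating_system B ->
    (forall a x, A a -> (word_length B (f (a * x)%g / f x) <= c)%N) ->
  lipschitz A B c f.
Proof.
move=> sA sB fA x y.
have [w [<- Aw wE]] := (word_lengthP sA (x / y)).1.
have -> : x = \prod_(a <- w) a * y by rewrite wE mulgVK.
elim: w Aw {wE} => [|a w IHw] Aw.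
  by rewrite big_nil mul1g mulgV word_length1.
rewrite big_cons -mulgA /= mulnS; set z := _ * y.
rewrite -(divgKA (f z)); apply: leq_trans (word_lengthM sB _ _) _.
apply: leq_add; first by apply: fA; apply: Aw; rewrite mem_head.
by apply: IHw => b wb; apply: Aw; rewrite inE wb orbT.
Qed.

(** A morphism sending generators to generators preserves edges; this bounds the
    length of an element of [A] inside a wreath product. *)
Lemma morph_word_length (G H : groupType) (A : set G) (B : set H)
    (h : UMagmaMorphism.type G H) :
    symmetric_generating_system A -> symmetric_generating_system B ->
    (forall a, A a -> B (h a)) ->
  forall x, (word_length B (h x) <= word_length A x)%N.
Proof.
move=> sA sB hAB x.
have hlip: lipschitz A B 1 h.
  apply: lipschitz_edges => // a y Aa.
  by rewrite gmulfM mulgK; apply/(word_length_gen sB)/hAB.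
by have := hlip x 1; rewrite gmulf1 !divg1 mul1n.
Qed.

Lemma bilipschitz_quasi_isometric (R : realType) (G H : groupType)
    (A : set G) (B : set H) (c : nat) (f : G -> H) (g : H -> G) :
    symmetric_generating_system A -> symmetric_generating_system B ->
    (0 < c)%N -> cancel f g -> cancel g f ->
    lipschitz A B c f -> lipschitz B A c g ->
  quasi_isometric R G H.
Proof.
move=> sA sB c_gt0 fK gK lf lg; exists A, B; split=> //; exists f.
exists c%:R%R, 0%R; split=> // [||y].
- by rewrite ler1n.
- move=> x y; rewrite subr0 addr0 /word_metric; apply/andP; split.
    rewrite ler_pdivrMl ?ltr0n // -natrM ler_nat.
    by have := lg (f x) (f y); rewrite !fK.
  by rewrite -natrM ler_nat.
- by exists (g y); rewrite gK /word_metric mulgV word_length1.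
Qed.

(** * Restricted wreath products *)

Definition finitely_supported (A B : groupType) (f : B -> A) : Prop :=
  exists s : seq B, forall x, x \notin s -> f x = 1.

(** The functional description: [lamp] is a finitely supported configuration
    on [B] with values in [A], and [cursor] is the component in [B]. *)
Record wreath (A B : groupType) := Wreath {
  lamp : B -> A;
  cursor : B;
  lampP : finitely_supported lamp
}.

HB.instance Definition _ (A B : groupType) := gen_eqMixin (wreath A B).
HB.instance Definition _ (A B : groupType) := gen_choiceMixin (wreath A B).

Section WreathGroup.
Variables A B : groupType.
Local Notation W := (wreath A B).
Implicit Types u v w : W.

Lemma wreath_eq u v : lamp u =1 lamp v -> cursor u = cursor v -> u = v.
Proof.
case: u v => [f b fs] [g c gs] /= /funext fg bc.
by case: _ / fg gs; case: _ / bc => gs; rewrite (Prop_irrelevance fs gs).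
Qed.

Lemma finitely_supported1 : finitely_supported (fun _ : B => 1 : A).
Proof. by exists [::]. Qed.

Lemma finitely_supportedM u v :
  finitely_supported (fun x => lamp u x * lamp v (x * cursor u)).
Proof.
have [[s fs] [t gt]] := (lampP u, lampP v).
exists (s ++ [seq y / cursor u | y <- t]) => x.
rewrite mem_cat negb_or => /andP[/fs-> nt]; rewrite mul1g gt //.
by apply: contra nt => nt; apply/mapP; exists (x * cursor u); rewrite ?mulgK.
Qed.

Lemma finitely_supportedV u :
  finitely_supported (fun x => (lamp u (x / cursor u))^-1).
Proof.
have [s fs] := lampP u; exists [seq y * cursor u | y <- s] => x ns.
rewrite fs ?invg1 //.
by apply: contra ns => ns; apply/mapP; exists (x / cursor u); rewrite ?mulgVK.
Qed.

Definition wreath_one : W := Wreath 1 finitely_supported1.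
Definition wreath_mul u v : W :=
  Wreath (cursor u * cursor v) (finitely_supportedM u v).
Definition wreath_inv u : W := Wreath (cursor u)^-1 (finitely_supportedV u).

Lemma wreath_mulA : associative wreath_mul.
Proof. by move=> u v w; apply: wreath_eq => [x|] /=; rewrite !mulgA. Qed.
Lemma wreath_mul1 : left_id wreath_one wreath_mul.
Proof. by move=> u; apply: wreath_eq => [x|] /=; rewrite ?mulg1 mul1g. Qed.
Lemma wreath_mulr1 : right_id wreath_one wreath_mul.
Proof. by move=> u; apply: wreath_eq => [x|] /=; rewrite mulg1. Qed.
Lemma wreath_mulV : left_inverse wreath_one wreath_inv wreath_mul.
Proof. by move=> u; apply: wreath_eq => [x|] /=; rewrite mulVg. Qed.
Lemma wreath_mulrV : right_inverse wreath_one wreath_inv wreath_mul.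
Proof. by move=> u; apply: wreath_eq => [x|] /=; rewrite ?mulgK mulgV. Qed.

HB.instance Definition _ := isGroup.Build (wreath A B)
  wreath_mulA wreath_mul1 wreath_mulr1 wreath_mulV wreath_mulrV.

Lemma cursorM u v : cursor (u * v) = cursor u * cursor v. Proof. by []. Qed.
Lemma cursorV u : cursor u^-1 = (cursor u)^-1. Proof. by []. Qed.
Lemma cursor1 : cursor (1 : W) = 1. Proof. by []. Qed.
Lemma lampM u v x : lamp (u * v) x = lamp u x * lamp v (x * cursor u).
Proof. by []. Qed.
Lemma lampV u x : lamp u^-1 x = (lamp u (x / cursor u))^-1. Proof. by []. Qed.
Lemma lamp1 x : lamp (1 : W) x = 1. Proof. by []. Qed.

Definition wreathE := (cursorM, cursorV, cursor1, lampM, lampV, lamp1).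

HB.instance Definition _ :=
  isGroupMorphism.Build W B (@cursor A B)
    (fun u v => erefl : cursor (u / v) = cursor u / cursor v).

Lemma finitely_supported_single (x : B) (a : A) :
  finitely_supported (fun y => if y == x then a else 1).
Proof. by exists [:: x] => y; rewrite inE => /negPf->. Qed.

Definition single x a : W := Wreath 1 (finitely_supported_single x a).
Definition shift b : W := Wreath b finitely_supported1.

Lemma single_morph x : {morph single x : a b / a / b}.
Proof.
move=> a b; apply: wreath_eq => [y|]; rewrite !wreathE /= ?invg1 ?mulg1 //.
by case: eqP; rewrite ?invg1 ?mulg1.
Qed.

HB.instance Definition _ x := isGroupMorphism.Build A W (single x) (single_morph x).

Lemma shift_morph : {morph shift : b c / b / c}.
Proof. by move=> b c; apply: wreath_eq => [y|]; rewrite !wreathE /= ?invg1 ?mulg1. Qed.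

HB.instance Definition _ := isGroupMorphism.Build B W shift shift_morph.

(** The action on positions is on the right, whence the inverse: the shift by
    [b] moves the lamp at [1] to [b^-1]. *)
Lemma single_conj x a : single x a = shift x^-1 * single 1 a * shift x.
Proof.
apply: wreath_eq => [y|]; rewrite !wreathE /= ?mulg1 ?mul1g ?mulVg //.
by rewrite -divg_eq1.
Qed.

Definition wreath_gens (S : set A) (T : set B) : set W :=
  single 1 @` S `|` shift @` T.

(** Conjugating the copy of [A] at the identity by shifts moves it to every
    position, and finitely many such copies switch off all the lamps of an
    element; what remains is a shift. *)
Lemma wreath_gens_generate S T : generated S = [set: A] -> generated T = [set: B] ->
  generated (wreath_gens S T) = [set: W].
Proof.
move=> genS genT; apply/seteqP; split=> // u _.
have sN := generated_subgroup (wreath_gens S T).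
have Nsub := @sub_generated _ (wreath_gens S T).
move: (generated _) sN Nsub => N sN Nsub; have [_ NM _] := sN.
have Nsingle1 a : N (single 1 a).
  apply: (@generated_morph _ _ (single 1) S) => //; last by rewrite genS.
  by move=> s Ss; apply: Nsub; left; exists s.
have Nshift b : N (shift b).
  apply: (@generated_morph _ _ shift T) => //; last by rewrite genT.
  by move=> t Tt; apply: Nsub; right; exists t.
have Nsingle x a : N (single x a).
  by rewrite single_conj; do 2?apply: (NM).
have [s] := lampP u; elim: s u => [|x s IHs] u us.
  suff -> : u = shift (cursor u) by [].
  by apply: wreath_eq => // x; rewrite us.
(* Switch off the lamp at [x], so that [s] supports the other factor. *)
rewrite -(mulKg (single x (lamp u x))^-1 u) invgK.
apply: NM => //; apply: IHs => y ys.
rewrite !wreathE /= invg1 !mulg1.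
have [->|yx] := eqVneq y x; first by rewrite mulVg.
by rewrite invg1 mul1g us // inE negb_or yx.
Qed.

Lemma wreath_gens_sgs S T :
  symmetric_generating_system S -> symmetric_generating_system T ->
  symmetric_generating_system (wreath_gens S T).
Proof.
move=> [finS SV genS] [finT TV genT]; split.
- by rewrite finite_setU; split; apply: finite_image.
- move=> _ [[s Ss <-]|[t Tt <-]]; rewrite -gmulfV; [left|right].
    by exists s^-1 => //; apply: SV.
  by exists t^-1 => //; apply: TV.
- exact: wreath_gens_generate.
Qed.

End WreathGroup.

(** * Quasi-isometry of wreath products *)

Section WreathMap.
Variables (A1 A2 B : groupType) (f : A1 -> A2).
Hypothesis f1 : f 1 = 1.

Lemma finitely_supported_map (u : wreath A1 B) : finitely_supported (f \o lamp u).
Proof. by have [s us] := lampP u; exists s => x /us /= ->. Qed.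

Definition wreath_map (u : wreath A1 B) : wreath A2 B :=
  Wreath (cursor u) (finitely_supported_map u).

(** Left multiplication by a generator either translates the whole
    configuration, which commutes with applying [f] to every lamp, or alters the
    lamp at the identity only; so an edge is stretched as much as [f] stretches
    the edges of [A1]. *)
Lemma wreath_map_lipschitz (S1 : set A1) (S2 : set A2) (T : set B) c :
    symmetric_generating_system S1 -> symmetric_generating_system S2 ->
    symmetric_generating_system T -> (0 < c)%N ->
    lipschitz S1 S2 c f ->
  lipschitz (wreath_gens S1 T) (wreath_gens S2 T) c wreath_map.
Proof.
move=> sS1 sS2 sT c_gt0 lf.
have sW1 := wreath_gens_sgs sS1 sT; have sW2 := wreath_gens_sgs sS2 sT.
apply: lipschitz_edges => // _ u [[a S1a <-]|[t Tt <-]].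
  have -> : wreath_map (single 1 a * u) / wreath_map u =
            single 1 (f (a * lamp u 1) / f (lamp u 1)).
    apply: wreath_eq => [x|]; rewrite !wreathE /= ?mul1g ?mulgV //.
    by rewrite mulg1 mulgK; case: eqP => [->|_]; rewrite // mul1g mulgV.
  apply: leq_trans (morph_word_length (h := single 1) sS2 sW2 _ _) _.
    by move=> s S2s; left; exists s.
  apply: leq_trans (lf _ _) _; rewrite mulgK -[leqRHS]muln1 leq_mul2l.
  by rewrite (word_length_gen sS1) ?orbT.
apply: leq_trans c_gt0; apply: word_length_gen => //; right; exists t => //.
apply: wreath_eq => [x|]; rewrite !wreathE /= ?mulgK //.
by rewrite mul1g mulgA mulgK mulgV.
Qed.

End WreathMap.

Lemma wreath_quasi_isometric (R : realType) (A1 A2 B : groupType)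
    (S1 : set A1) (S2 : set A2) (T : set B) c (f : A1 -> A2) (g : A2 -> A1) :
    symmetric_generating_system S1 -> symmetric_generating_system S2 ->
    symmetric_generating_system T -> (0 < c)%N ->
    f 1 = 1 -> cancel f g -> cancel g f ->
    lipschitz S1 S2 c f -> lipschitz S2 S1 c g ->
  quasi_isometric R (wreath A1 B) (wreath A2 B).
Proof.
move=> sS1 sS2 sT c_gt0 f1 fK gK lf lg.
have g1 : g 1 = 1 by rewrite -f1 fK.
apply: (bilipschitz_quasi_isometric R (wreath_gens_sgs sS1 sT)
  (wreath_gens_sgs sS2 sT) c_gt0 (f := wreath_map f1) (g := wreath_map g1)).
- by move=> u; apply: wreath_eq => [x|] //=; rewrite fK.
- by move=> u; apply: wreath_eq => [x|] //=; rewrite gK.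
- exact: wreath_map_lipschitz.
- exact: wreath_map_lipschitz.
Qed.

(** * Solvability and torsion of wreath products *)

(** An element of finite order has trivial cursor because [B] is torsion-free;
    its powers are then computed pointwise. *)
Lemma wreath_torsion_free (A B : groupType) :
  torsion_free A -> torsion_free B -> torsion_free (wreath A B).
Proof.
move=> tfA tfB u _ [n n_gt0 un1].
have cu1 : cursor u = 1.
  by apply: tfB => //; exists n => //; rewrite -(gmulfXn (@cursor A B)) un1.
have lampX m x : lamp (u ^+ m) x = lamp u x ^+ m.
  by elim: m => [//|m IHm]; rewrite !expgS lampM cu1 mulg1 IHm.
apply: wreath_eq => // x; rewrite lamp1; apply: tfA => //; exists n => //.
by rewrite -lampX un1.
Qed.

(** Commutators have trivial cursor since [B] is abelian, and the elements with
    trivial cursor commute since they multiply pointwise in [A]. *)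
Lemma wreath_metabelian (A B : groupType) :
    (forall a b : A, a * b = b * a) -> (forall a b : B, a * b = b * a) ->
  solvable_group (wreath A B).
Proof.
move=> commA commB; exists 2%N => /=.
have cursor_derived : derived [set: wreath A B] `<=` [set u | cursor u = 1].
  apply: derived_sub => [|u v _ _].
    by split=> [|u v u1 v1|u u1] /=; rewrite ?u1 ?v1 ?mulg1 ?invg1.
  by rewrite /mkset (gmulfR (@cursor A B)); apply/eqP/commgP/commB.
apply/seteqP; split=> [|_ ->]; last first.
  by have [] := derived_subgroup (derived [set: wreath A B]).
apply: derived_sub => [|u v /cursor_derived /= u1 /cursor_derived /= v1].
  exact: is_subgroup1.
apply/eqP/commgP; apply: wreath_eq => [x|]; rewrite !wreathE u1 v1 //.
by rewrite mulg1 commA.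
Qed.

(** There are finitely many functions from [I] to the cosets of [K], whereas
    every position [x] in the infinite group [B] gives one, namely
    [i |-> K (single x (a i))]; two positions give the same one.  Asking for
    all [i] at once is what lets a single position [x] exhibit a whole finite
    group in the proof of [wreath_not_virtually_solvable]. *)
Lemma finite_index_twin (A B : groupType) (I : finType) (a : I -> A)
    (K : set (wreath A B)) :
    infinite_set [set: B] -> is_subgroup K -> finite_index K ->
  exists x y : B, x != y /\ forall i, K (single x (a i) / single y (a i)).
Proof.
move=> infB sK /finite_seqP[cosets cosetsE].
have [K1 _ _] := sK.
pose coset u : set (wreath A B) := [set k * u | k in K].
have coset_lt u : (index (coset u) cosets < size cosets)%N.
  rewrite index_mem; suff : [set` cosets] (coset u) by [].
  by rewrite -cosetsE; exists u.
have cosetP u v : index (coset u) cosets = index (coset v) cosets -> K (u / v).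
  move=> uv; have uvE : coset u = coset v.
    by rewrite -(nth_index set0 (s := cosets) (x := coset u)) -?index_mem // uv
       nth_index // -index_mem.
  have : coset u u by exists 1; rewrite ?mul1g.
  by rewrite uvE => -[k Kk <-]; rewrite mulgK.
pose colour (x : B) : {ffun I -> 'I_(size cosets)} :=
  [ffun i => Ordinal (coset_lt (single x (a i)))].
have [X _ cardX] := infinite_set_fset #|{ffun I -> 'I_(size cosets)}|.+1 infB.
have [|noinj] := pselect (injective (fun x : X => colour (fsval x))).
  by move=> /leq_card; rewrite -cardfE leqNgt cardX.
have [x [y [xy eqxy]]] : exists x y : X, x != y /\ colour (fsval x) = colour (fsval y).
  apply: contra_notP noinj => nex x y xy; apply/eqP; apply/negPn/negP => nxy.
  by apply: nex; exists x, y.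
exists (fsval x), (fsval y); split=> // i; apply: cosetP.
by have /ffunP/(_ i) := eqxy; rewrite !ffunE => -[].
Qed.

(** The element provided by [finite_index_twin] has the torsion element [a]
    and its inverse at two distinct positions, so it has finite order. *)
Lemma wreath_not_virtually_torsion_free (A B : groupType) (a : A) :
    infinite_set [set: B] -> a != 1 -> finite_order a ->
  forall K : set (wreath A B),
    is_subgroup K -> finite_index K -> ~ torsion_free_subgroup K.
Proof.
move=> infB a1 [n n_gt0 an1] K sK fK tfK.
have [x [y [xy /(_ tt) Kxy]]] := finite_index_twin (fun _ : unit => a) infB sK fK.
set u := _ / _ in Kxy.
have un1 : u ^+ n = 1.
  rewrite expgnFl; last first.
    apply: wreath_eq => [z|]; rewrite !wreathE //= !mulg1.
    by case: (eqVneq z x) => [->|]; rewrite ?(negPf xy) ?mulg1 ?mul1g.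
  by rewrite -(gmulfXn (single x)) -(gmulfXn (single y)) an1 !gmulf1 divg1.
have : lamp u x = 1 by rewrite (tfK u) //; exists n.
by rewrite /u lampM lampV /= eqxx divg1 mulg1 (negPf xy) divg1; apply/eqP.
Qed.

(** On elements with trivial cursor, reading the lamp at [x] is a morphism to
    [gT]; by [finite_index_twin] it maps those of [K] onto [gT] for a suitable
    [x].  A surjection restricts to surjections between the derived series, and
    that of [gT] never becomes trivial. *)
Lemma wreath_not_virtually_solvable (gT : finGroupType) (B : groupType) :
    infinite_set [set: B] -> ~~ nilpotent.solvable [set: gT]%G ->
  ~ virtually_solvable (wreath gT B).
Proof.
move=> infB nsol [K [sK fK [n derK1]]]; case/negP: nsol.
apply/nilpotent.derivedP; exists n; apply/trivgP/fintype.subsetP => g.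
have [x [y [xy Kxy]]] := finite_index_twin (fun g : gT => g) infB sK fK.
suff lift m : forall g, g \in [set: gT]%G^`(m)%g ->
    exists k, [/\ iter m (@derived _) K k, cursor k = 1 & lamp k x = g].
  by move=> /lift[k []]; rewrite derK1 => -> _ <-; rewrite !wreathE inE.
elim: m => [|m IHm] {}g.
  (* The lamp [g^-1] at [y] is invisible at [x]. *)
  exists (single x g / single y g); split; rewrite // /= ?divg1 //.
  by rewrite mulg1 eqxx (negPf xy) divg1.
(* The values at [x] form a group, so it suffices to reach commutators. *)
pose D := [set h : gT | `[< exists k,
  [/\ iter m.+1 (@derived _) K k, cursor k = 1 & lamp k x = h] >]]%SET.
have memD h k : iter m.+1 (@derived _) K k -> cursor k = 1 -> lamp k x = h ->
  h \in D by move=> *; rewrite inE; apply/asboolP; exists k.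
have exD h : h \in D -> exists k,
    [/\ iter m.+1 (@derived _) K k, cursor k = 1 & lamp k x = h].
  by rewrite inE => /asboolP.
have [K1 KM _] := derived_subgroup (iter m (@derived _) K).
have grD : group_set D.
  apply/group_setP; split; first exact: (memD _ 1).
  move=> _ _ /exD[k1 [d1 c1 <-]] /exD[k2 [d2 c2 <-]].
  apply: (memD _ (k1 * k2)); first exact: KM.
    by rewrite !wreathE c1 c2 mulg1.
  by rewrite !wreathE c1 mulg1.
suff: [set: gT]%G^`(m.+1)%g \subset group grD.
  by move=> /fintype.subsetP/[apply] /exD.
rewrite gen_subG; apply/fintype.subsetP => h /imset2P[h1 h2].
move=> /IHm[k1 [d1 c1 <-]] /IHm[k2 [d2 c2 <-]] -> {h}.
apply: (memD _ [~ k1, k2]); first exact: commutator_derived.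
  by rewrite (gmulfR (@cursor gT B)) /= c1 c2 commg1.
by rewrite !commgEl !conjgE !wreathE c1 c2 !invg1 ?mulg1.
Qed.

(** * Abelian groups in multiplicative notation *)

(** [groupType] is written multiplicatively, so an additive group needs an alias
    to carry that structure. *)
Definition multiplicative (V : zmodType) : Type := V.

HB.instance Definition _ (V : zmodType) := Choice.on (multiplicative V).

HB.instance Definition _ (V : zmodType) := isGroup.Build (multiplicative V)
  (@addrA V) (@add0r V) (@addr0 V) (@addNr V) (@addrN V).

Lemma multiplicativeC (V : zmodType) (x y : multiplicative V) : x * y = y * x.
Proof. exact: addrC. Qed.

Lemma multiplicativeX (V : zmodType) (x : multiplicative V) n :
  x ^+ n = ((x : V) *+ n)%R.
Proof. by elim: n => [//|n IHn]; rewrite expgS mulrS IHn. Qed.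

Local Notation Z := (multiplicative int).

Definition Z_gens : set Z := [set (1%R : Z); ((- 1)%R : Z)].

Lemma Z_gens_sgs : symmetric_generating_system Z_gens.
Proof.
split; first exact: finite_set2.
- by move=> _ [->|->]; [right|left].
- apply/seteqP; split=> // n _.
  have [K1 KM KV] := generated_subgroup Z_gens.
  elim/int_rect: n => [|n IHn|n IHn]; first exact: K1.
  + rewrite -addn1 PoszD; apply: (KM n%:Z 1)%R => //.
    by apply: sub_generated; left.
  + rewrite -addn1 PoszD opprD; apply: (KM (- n%:Z) (- 1))%R => //.
    by apply: sub_generated; right.
Qed.

Lemma Z_torsion_free : torsion_free Z.
Proof.
move=> x _ [n n_gt0]; rewrite multiplicativeX => /eqP.
by rewrite mulrn_eq0 eqn0Ngt n_gt0 => /eqP.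
Qed.

Lemma Z_infinite : infinite_set [set: Z].
Proof.
move=> /(finite_image absz); suff -> : absz @` [set: Z] = [set: nat].
  exact: infinite_nat.
by apply/seteqP; split=> // n _; exists (n%:Z)%R.
Qed.

Lemma finite_lipschitz (G H : groupType) (f : G -> H) :
    finite_set [set: G] -> finite_set [set: H] ->
  lipschitz [set: G] [set: H] 1 f.
Proof.
move=> /sgs_setT sG /sgs_setT sH.
by apply: lipschitz_edges => // a x _; apply: word_length_gen.
Qed.

(** Any bijection can be corrected by a transposition of the target. *)
Lemma card_eq_pointed_bijection (T U : finType) (t : T) (u : U) : #|T| = #|U| ->
  exists (f : T -> U) (g : U -> T), [/\ f t = u, cancel f g & cancel g f].
Proof.
move=> TU; pose f0 x : U := enum_val (cast_ord TU (enum_rank x)).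
pose g0 y : T := enum_val (cast_ord (esym TU) (enum_rank y)).
have f0K : cancel f0 g0 by move=> x; rewrite /g0 enum_valK cast_ordK enum_rankK.
have g0K : cancel g0 f0 by move=> x; rewrite /f0 enum_valK cast_ordKV enum_rankK.
exists (fun x => tperm (f0 t) u (f0 x)), (fun y => g0 (tperm (f0 t) u y)).
by split=> [|x|y]; rewrite ?tpermL ?tpermK ?f0K // g0K tpermK.
Qed.

Lemma finite_wreath_quasi_isometric (R : realType) (gT : finGroupType) n :
    #|gT| = n.+1 ->
  quasi_isometric R (wreath (multiplicative 'I_n.+1) Z) (wreath gT Z).
Proof.
move=> cardG.
have [|f [g [f1 fK gK]]] := @card_eq_pointed_bijection 'I_n.+1 gT 0%R 1.
  by rewrite card_ord.
have finI : finite_set [set: multiplicative 'I_n.+1] := @finite_finset 'I_n.+1 setT.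
have finG : finite_set [set: gT] by [].
apply: (wreath_quasi_isometric R (sgs_setT finI) (sgs_setT finG) Z_gens_sgs
  (ltn0Sn 0) f1 fK gK); exact: finite_lipschitz.
Qed.

(** * The integers and their product with a group of order two *)

Local Notation C2Z := (multiplicative (bool * int)%type).

Definition C2Z_gens : set C2Z :=
  [set ((true, 0%R) : C2Z)] `|` [set ((false, 1%R) : C2Z); ((false, (-1)%R) : C2Z)].

Lemma C2Z_gens_sgs : symmetric_generating_system C2Z_gens.
Proof.
split.
- by rewrite finite_setU; split; [exact: finite_set1 | exact: finite_set2].
- by move=> _ [->|[->|->]]; [left|right; right|right; left].
- apply/seteqP; split=> // -[b n] _.
  have [K1 KM KV] := generated_subgroup C2Z_gens.
  have Kn : generated C2Z_gens ((false, n) : C2Z).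
    elim/int_rect: n => [|n IHn|n IHn]; first exact: K1.
    + rewrite -addn1 PoszD; apply: (KM (false, (n%:Z)%R) (false, 1%R)) => //.
      by apply: sub_generated; right; left.
    + rewrite -addn1 PoszD opprD; apply: (KM (false, (- n%:Z)%R) (false, (-1)%R)) => //.
      by apply: sub_generated; right; right.
  case: b => //; rewrite -[n]add0r; apply: (KM (true, 0%R) (false, n)) => //.
  by apply: sub_generated; left.
Qed.

Definition interleave (p : C2Z) : Z := ((p.1 : nat)%:Z + p.2 * 2)%R.
Definition split_parity (n : Z) : C2Z := ((n %% 2)%Z == 1%R, (n %/ 2)%Z).

Lemma interleaveK : cancel interleave split_parity.
Proof. by case=> b n; congr (_, _); case: b => /=; rewrite /interleave /=; lia. Qed.

Lemma split_parityK : cancel split_parity interleave.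
Proof. move=> n; rewrite /interleave /split_parity /=; case: eqP => /=; lia. Qed.

(** Adding [(0, 1)], [(0, -1)] or [(1, 0)] changes [interleave] by [2], [-2], or
    [1] or [-1] according to the carry, hence the constant [2]. *)
Lemma interleave_lipschitz : lipschitz C2Z_gens Z_gens 2 interleave.
Proof.
apply: lipschitz_edges C2Z_gens_sgs Z_gens_sgs _ => s [b m].
have len1 (z : Z) : Z_gens z -> (word_length Z_gens z <= 2)%N.
  by move=> /(word_length_gen Z_gens_sgs)/leqW.
have len2 (z : Z) : Z_gens z -> (word_length Z_gens (z * z)%g <= 2)%N.
  by move=> Az; exact: (word_length_mul_gens Z_gens_sgs Az Az).
have disp (p q : C2Z) (z : Z) : interleave (p * q) = z * interleave q ->
  interleave (p * q) / interleave q = z by move=> ->; rewrite mulgK.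
move=> [->|[->|->]].
- case: b; [rewrite (disp _ _ (-1)%R) | rewrite (disp _ _ 1%R)].
  + by apply: len1; right.
  + by rewrite /interleave /mul /=; lia.
  + by apply: len1; left.
  + by rewrite /interleave /mul /=; lia.
- rewrite (disp _ _ ((1%R : Z) * (1%R : Z))); first by apply: len2; left.
  by case: b; rewrite /interleave /mul /=; lia.
- rewrite (disp _ _ (((-1)%R : Z) * ((-1)%R : Z))); first by apply: len2; right.
  by case: b; rewrite /interleave /mul /=; lia.
Qed.

(** Passing from [n] to [n + 1] or [n - 1] flips the parity and changes the half
    by at most one, hence a displacement of length at most [2]. *)
Lemma split_parity_lipschitz : lipschitz Z_gens C2Z_gens 2 split_parity.
Proof.
apply: lipschitz_edges Z_gens_sgs C2Z_gens_sgs _ => s n.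
rewrite -(split_parityK n); move: (split_parity n) => [b m].
have sC := C2Z_gens_sgs.
have A0 : C2Z_gens (true, 0%R) by left.
have disp (p q : C2Z) (z : Z) : z * interleave q = interleave (p * q) ->
  split_parity (z * interleave q) / split_parity (interleave q) = p.
  by move=> ->; rewrite !interleaveK mulgK.
move=> [->|->]; case: b.
- rewrite (disp (((true, 0%R) : C2Z) * ((false, 1%R) : C2Z))).
    by apply: word_length_mul_gens => //; right; left.
  by rewrite /interleave /mul /=; lia.
- rewrite (disp (true, 0%R)); first exact/leqW/word_length_gen.
  by rewrite /interleave /mul /=; lia.
- rewrite (disp (true, 0%R)); first exact/leqW/word_length_gen.
  by rewrite /interleave /mul /=; lia.
- rewrite (disp (((true, 0%R) : C2Z) * ((false, (-1)%R) : C2Z))).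
    by apply: word_length_mul_gens => //; right; right.
  by rewrite /interleave /mul /=; lia.
Qed.

Lemma Z_C2Z_wreath_quasi_isometric (R : realType) :
  quasi_isometric R (wreath Z Z) (wreath C2Z Z).
Proof.
exact: (wreath_quasi_isometric R Z_gens_sgs C2Z_gens_sgs Z_gens_sgs _
  _ split_parityK interleaveK split_parity_lipschitz interleave_lipschitz).
Qed.

Theorem proposition1 (R : realType) :
  (exists G H : groupType,
     [/\ finitely_generated G, finitely_generated H, quasi_isometric R G H,
         solvable_group G & ~ virtually_solvable H])
  /\
  (exists G H : groupType,
     [/\ finitely_generated G, finitely_generated H, quasi_isometric R G H,
         torsion_free G
       & forall K : set H,
           is_subgroup K -> finite_index K -> ~ torsion_free_subgroup K]).
Proof.
have fg_of_qi (G H : groupType) : quasi_isometric R G H ->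
    finitely_generated G /\ finitely_generated H.
  by move=> [A [B [sA sB _]]]; split;
    [exact: finitely_generated_sgs sA | exact: finitely_generated_sgs sB].
split.
  pose n := #|{perm 'I_5}|.-1.
  have cardS5 : #|{perm 'I_5}| = n.+1.
    by rewrite prednK // (cardD1 1).
  have qi := finite_wreath_quasi_isometric R cardS5.
  have [fgG fgH] := fg_of_qi _ _ qi.
  exists (wreath (multiplicative 'I_n.+1) Z), (wreath {perm 'I_5} Z); split => //.
    by apply: wreath_metabelian; exact: multiplicativeC.
  apply: wreath_not_virtually_solvable; first exact: Z_infinite.
  by rewrite alt.solvable_SymF ?card_ord.
have qi := Z_C2Z_wreath_quasi_isometric R.
have [fgG fgH] := fg_of_qi _ _ qi.
exists (wreath Z Z), (wreath C2Z Z); split => //.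
  by apply: wreath_torsion_free; exact: Z_torsion_free.
apply: (@wreath_not_virtually_torsion_free C2Z Z (true, 0%R)) => //.
  exact: Z_infinite.
by exists 2%N.
Qed.
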